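(* Let $\mathsf{allSys}^{\mathsf{ef}}$ be the category of all dynamical systems with embedding-factor pairs as morphisms. For a full subcategory $\mathsf{S}^{\mathsf{ef}}$ of $\mathsf{allSys}^{\mathsf{ef}}$ consider the conditions: (A) If $\big((X_i,T_i),(e_{i\,i+1},f_{i\,i+1})\big)_{i\in\omega}$ is an $\omega$-chain in $\mathsf{S}^{\mathsf{ef}}$, then $(X,T)$ is again in $\mathsf{S}^{\mathsf{ef}}$, where $X:=\{\langle x_i\rangle\in\prod_{i\in\omega}X_i: f_{ij}(x_j)=x_i\text{ for all }i\leq j\}$ carries the subspace topology of the product topology, $f_i:X\to X_i$ are the canonical projections, and $T(x):=\{x'\in X:\forall i\in\omega.\ f_i(x)\xrightarrow{T_i}f_i(x')\}$. (B) If $(X,T)$ is in $\mathsf{S}^{\mathsf{ef}}$ and $f:X\to Y$ is a continuous surjection onto a finite discrete space $Y$, then $(Y,S)$ is in $\mathsf{S}^{\mathsf{ef}}$, where $S(y)=\{y'\in Y:\exists x,x'\in X.\ y=f(x),\ x\xrightarrow{T}x',\ f(x')=y'\}$. Then each of the following full subcategories of $\mathsf{allSys}^{\mathsf{ef}}$ satisfies both (A) and (B): (1) $\mathsf{allSys}^{\mathsf{ef}}$ itself; (2) $\mathsf{Sys}^{\mathsf{ef}}$, consisting of all nontrivial systems; (3) $\mathsf{totalSys}^{\mathsf{ef}}$, consisting of all total and nontrivial systems.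
   Context: Multifunctions. A multifunction $F:X\rightrightarrows Y$ assigns to each $x\in X$ a subset $F(x)\subseteq Y$; write $x\xrightarrow{F}y$ for $y\in F(x)$ and $F[A]=\bigcup_{x\in A}F(x)$; composition is $(G\circ F)(x)=G[F(x)]$; functions are identified with singleton-valued multifunctions. $F$ is total if every $F(x)\neq\emptyset$; partition-injective if $F(x)\cap F(x')=\emptyset$ for $x\neq x'$ and every $y\in Y$ lies in some $F(x)$; closed-valued if every $F(x)$ is closed; upper-hemicontinuous if for every $x$ and open $V\supseteq F(x)$ there is an open $U\ni x$ with $F(x')\subseteq V$ for all $x'\in U$. Dynamical systems. A dynamical system is a pair $(X,T)$ with $X$ a zero-dimensional, second-countable, compact Hausdorff space and $T:X\rightrightarrows X$ a closed-valued, upper-hemicontinuous multifunction. It is nontrivial if $x\xrightarrow{T}x'$ for some $x,x'\in X$, and total if $T$ is total. Morphisms. A system morphism $\varphi:(X,T)\to(Y,S)$ is a closed-valued, upper-hemicontinuous multifunction $\varphi:X\rightrightarrows Y$ such that (i) if $x\xrightarrow{T}x'$, there are $y,y'$ with $x\xrightarrow{\varphi}y$, $x'\xrightarrow{\varphi}y'$, $y\xrightarrow{S}y'$; (ii) if $y\xrightarrow{S}y'$, there are $x,x'$ with $x\xrightarrow{\varphi}y$, $x'\xrightarrow{\varphi}y'$, $x\xrightarrow{T}x'$. It is a factor if it is a surjective function and (iii) whenever $x\xrightarrow{\varphi}y$ and $x\xrightarrow{T}x'$ there is $y'$ with $y\xrightarrow{S}y'$ and $x'\xrightarrow{\varphi}y'$.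 It is an embedding if it is total and partition-injective and (iv) whenever $x\xrightarrow{\varphi}y$ and $y\xrightarrow{S}y'$ there is $x'$ with $x\xrightarrow{T}x'$ and $x'\xrightarrow{\varphi}y'$. An embedding-factor pair (ef-pair) $(e,f):(X,T)\to(Y,S)$ consists of an embedding $e:(X,T)\to(Y,S)$ and a factor $f:(Y,S)\to(X,T)$ with $f\circ e(x)=\{x\}$ for all $x$ and $y\in e\circ f(y)$ for all $y$. Composition: $(e',f')\circ(e,f)=(e'\circ e,f\circ f')$. An $\omega$-chain is a sequence of objects with morphisms from each to the next; in a chain of ef-pairs, $f_{i\,i+1}:X_{i+1}\to X_i$ denotes the factor and $f_{ij}:X_j\to X_i$ ($i\leq j$) the composite of factors. *)

(* Defs.v *)
From HB Require Import structures.
From mathcomp Require Import all_boot all_classical topology.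

Set Implicit Arguments.
Unset Strict Implicit.
Unset Printing Implicit Defensive.

Local Open Scope classical_set_scope.

Section Multifunctions.
Variables X Y Z : topologicalType.

Definition mcomp (G : Y -> set Z) (F : X -> set Y) : X -> set Z :=
  fun x => \bigcup_(y in F x) G y.

Definition mfun (f : X -> Y) : X -> set Y := fun x => [set f x].

Definition mtotal (F : X -> set Y) := forall x, F x !=set0.

Definition partition_injective (F : X -> set Y) :=
  (forall x x', x <> x' -> F x `&` F x' = set0) /\
  (forall y, exists x, F x y).

Definition closed_valued (F : X -> set Y) := forall x, closed (F x).

Definition upper_hemicontinuous (F : X -> set Y) :=
  forall x (V : set Y), open V -> F x `<=` V ->
    exists U : set X, [/\ open U, U x & forall x', U x' -> F x' `<=` V].

End Multifunctions.

(* The library's [zero_dimensional] only asks that clopen sets separate points;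
   this is the textbook notion (small inductive dimension zero).  The two agree
   on compact Hausdorff spaces. *)
Definition clopen_basis (X : topologicalType) :=
  exists2 B : set (set X), B `<=` clopen & basis B.

Record relsys := RelSys {
  space :> topologicalType;
  step : space -> set space }.

Definition is_dynsys (X : relsys) :=
  [/\ clopen_basis X, @second_countable X, compact [set: X]
    & hausdorff_space X] /\
  (closed_valued (@step X) /\ upper_hemicontinuous (@step X)).

Record dynsys := DynSys {
  dynsys_sys :> relsys;
  dynsysP : is_dynsys dynsys_sys }.

Definition nontrivial (X : dynsys) := exists x x' : X, step x x'.

Definition total_sys (X : dynsys) := mtotal (@step X).

Section Morphisms.
Variables X Y : dynsys.

Definition is_morphism (phi : X -> set Y) :=
  [/\ closed_valued phi, upper_hemicontinuous phi,
      forall x x', step x x' ->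
        exists y y', [/\ phi x y, phi x' y' & step y y']
    & forall y y', step y y' ->
        exists x x', [/\ phi x y, phi x' y' & step x x']].

Definition is_embedding (e : X -> set Y) :=
  [/\ is_morphism e, mtotal e, partition_injective e
    & forall x y y', e x y -> step y y' -> exists2 x', step x x' & e x' y'].

Definition is_factor (f : X -> Y) :=
  [/\ is_morphism (mfun f), forall y, exists x, f x = y
    & forall x y x', mfun f x y -> step x x' ->
        exists2 y', step y y' & mfun f x' y'].

End Morphisms.

Record efpair (X Y : dynsys) := EFPair {
  emb : X -> set Y;
  fac : Y -> X;
  emb_embedding : is_embedding emb;
  fac_factor : is_factor fac;
  fac_emb : forall x, mcomp (mfun fac) emb x = [set x];
  emb_fac : forall y, mcomp emb (mfun fac) y y }.

(* A full subcategory of the category of dynamical systems and ef-pairs is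
   given by its class of objects; its morphisms are all the ef-pairs between
   these.  ([set dynsys] is not available: [set] lives in a smaller universe.) *)
Definition fullsubcat := dynsys -> Prop.

Record efchain (S : fullsubcat) := EFChain {
  chain_ob :> nat -> dynsys;
  chain_in : forall i, S (chain_ob i);
  chain_mor : forall i, efpair (chain_ob i) (chain_ob i.+1) }.

Section Limit.
Variables (S : fullsubcat) (C : efchain S).

(* [bond i k] is f_{ij} for j = k + i: indexing by the gap k = j - i avoids
   transports between [C j] and [C (j - i + i)]. *)
Fixpoint bond (i k : nat) : C (k + i)%N -> C i :=
  match k return C (k + i)%N -> C i with
  | 0 => fun x => x
  | k'.+1 => fun x => bond (fac (chain_mor C (k' + i)%N) x)
  end.

Definition limit_set : set (prod_topology (fun i => space (C i))) :=
  [set x | forall i k, @bond i k (x (k + i)%N) = x i].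

(* The library's topology on the sigma type of a set is the subspace topology. *)
Definition limit_space : topologicalType := set_type limit_set.

Definition limit_proj (i : nat) (x : limit_space) : C i := set_val x i.

Definition limit_sys : relsys :=
  @RelSys limit_space
    (fun x => [set x' | forall i, step (limit_proj i x) (limit_proj i x')]).

End Limit.

Definition image_sys (X : relsys) (Y : topologicalType) (f : X -> Y) : relsys :=
  @RelSys Y (fun y =>
    [set y' | exists x x' : X, [/\ y = f x, step x x' & f x' = y']]).

Definition obj_in (S : fullsubcat) (X : relsys) :=
  exists2 Z : dynsys, S Z & Z = X :> relsys.

Definition closed_under_limits (S : fullsubcat) :=
  forall C : efchain S, obj_in S (limit_sys C).

Definition closed_under_finite_images (S : fullsubcat) :=
  forall (X : dynsys) (Y : discreteTopologicalType) (f : X -> Y),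
    S X -> finite_set [set: Y] -> continuous f ->
    (forall y, exists x, f x = y) ->
    obj_in S (image_sys f).

Definition allSys : fullsubcat := fun _ => True.
Definition Sys : fullsubcat := nontrivial.
Definition totalSys : fullsubcat := fun X => total_sys X /\ nontrivial X.

(* Main.v *)
(* The main tool for (A) is the closed graph theorem: between compact
   Hausdorff spaces, closed-valued and upper-hemicontinuous means having a
   closed graph, and the graph of the limit multifunction is an intersection of
   preimages of closed graphs.  Clopen and countable bases lift because the
   cylinders over a single coordinate form a basis of an inverse limit.  A
   transition of X_0 lifts along the factors by condition (ii), which gives
   nontriviality of the limit; totality follows by compactness, the sets
   f_i^-1(T_i(f_i(x))) being nonempty, closed and decreasing.  In (B) all
   topological conditions are trivial on a finite discrete space. *)
Require Import Defs.
From mathcomp Require Import all_boot all_classical topology.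

Set Implicit Arguments.
Unset Strict Implicit.
Unset Printing Implicit Defensive.

Local Open Scope classical_set_scope.

(** * Closed graphs versus upper-hemicontinuity *)

(** If [y] is outside [F x], regularity gives a neighbourhood [W] of [y] whose closure misses [F x].
    Upper-hemicontinuity spreads this to some [U] around [x], and [U * W] misses the graph. *)
Lemma closed_graph (X Y : topologicalType) (F : X -> set Y) :
  compact [set: Y] -> hausdorff_space Y ->
  closed_valued F -> upper_hemicontinuous F ->
  closed [set p : X * Y | F p.1 p.2].
Proof.
move=> cptY hY clF uhcF [x y] clxy /=; apply: contrapT => nFxy.
have reg : {for y, regular_space Y}.
  by apply: (compact_regular hY cptY); exact: filterT.
have [W Wy sW] : filter_from (nbhs y) closure (~` F x).
  apply: reg; apply: open_nbhs_nbhs; split=> //.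
  exact/closed_openC/clF.
have [U [oU Ux sU]] : exists U, [/\ open U, U x &
    forall x', U x' -> F x' `<=` ~` closure W].
  apply: uhcF; first exact/closed_openC/closed_closure.
  by move=> z Fxz /sW.
have [] := clxy (U `*` W).
  by exists (U, W) => //; split=> //=; apply: open_nbhs_nbhs.
move=> [x' y'] [/= Fxy' [/sU sFV Wy']]; apply: (sFV _ Fxy').
exact: subset_closure.
Qed.

Lemma closed_graph_valued (X Y : topologicalType) (F : X -> set Y) :
  closed [set p : X * Y | F p.1 p.2] -> closed_valued F.
Proof.
move=> clG x y clFy; apply: (clG (x, y)) => A [[U V] /= [Ux Vy] sA].
have [z [Fxz Vz]] := clFy V Vy.
by exists (x, z); split=> //; apply: sA; split=> //=; exact: nbhs_singleton.
Qed.

(** This is the tube lemma, applied to the compact set of points outside [V]: near [x], no value of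
    [F] meets it. *)
Lemma closed_graph_uhc (X Y : topologicalType) (F : X -> set Y) :
  compact [set: Y] -> closed [set p : X * Y | F p.1 p.2] ->
  upper_hemicontinuous F.
Proof.
move=> cptY clG x V oV FV.
have /compact_near_coveringP cov : compact (~` V).
  by apply: (subclosed_compact _ cptY) => //; exact: open_closedC.
have : nbhs x [set x' | ~` V `<=` ~` F x'].
  apply: cov => y nVy.
  have : nbhs (x, y) (~` [set p : X * Y | F p.1 p.2]).
    by apply: open_nbhs_nbhs; split=> [|/= /FV //]; exact: closed_openC.
  (* The factors are swapped because a near-covering puts the compact variable first. *)
  case=> -[A B] /= [Ax By] sAB; exists (B, A) => // -[b a] [/= Bb Aa].
  exact: (sAB (a, b)).
rewrite nbhsE => -[U [oU Ux] sU]; exists U; split=> //.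
by move=> x' /sU /subsetC; rewrite !setCK.
Qed.

Lemma mfun_continuous (X Y : topologicalType) (f : X -> Y) :
  upper_hemicontinuous (mfun f) -> continuous f.
Proof.
move=> uhcf x A; rewrite nbhsE => -[V [oV Vx] sV].
have [|U [oU Ux sU]] := uhcf x V oV; first by move=> _ ->.
rewrite /nbhs /=; apply: (filterS _ (open_nbhs_nbhs (conj oU Ux))) => z /sU.
by move=> /(_ _ erefl) /sV.
Qed.

(** * Choice, compactness and lifting along towers *)

Lemma choice_dep (I : Type) (T : I -> Type) (P : forall i, T i -> Prop) :
  (forall i, exists x, P i x) -> exists f : forall i, T i, forall i, P i (f i).
Proof.
move=> exP; exists (fun i => sval (cid (exP i))) => i.
exact: svalP (cid (exP i)).
Qed.

Lemma closed_preimage2 (X Y Z : topologicalType) (D : set (Y * Z))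
    (f : X -> Y) (g : X -> Z) :
  closed D -> continuous f -> continuous g -> closed [set x | D (f x, g x)].
Proof.
move=> clD cf cg; have /continuous_closedP : continuous (fun x => (f x, g x)).
  by move=> x; apply: cvg_pair; [exact: cf|exact: cg].
exact.
Qed.

Lemma coord_continuous (Y : nat -> topologicalType) i :
  continuous (fun x : prod_topology Y => x i).
Proof. exact: proj_continuous. Qed.

(** A filter on the subtype is pushed forward to [X]. Its cluster point lies in [A], and it clusters
    in the subtype because open sets there are traces of open sets of [X]. *)
Lemma set_type_compact (X : topologicalType) (A : set X) :
  compact A -> compact [set: A].
Proof.
move=> cptA F PF _.
have FA : F (set_val @^-1` A).
  by apply: (filterS _ filterT) => x _; exact: set_valP.
have [x [Ax clx]] := cptA (set_val @ F) _ FA.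
exists (@exist _ _ x (mem_set Ax)); split=> // B D FB [_ [[W oW <-] Wx] sD].
have FvB : F (set_val @^-1` (set_val @` B)).
  by apply: filterS FB => z Bz; exists z.
have [_ [[z Bz <-] Wz]] := clx _ W FvB (open_nbhs_nbhs (conj oW Wx)).
by exists z; split=> //; exact: sD.
Qed.

Lemma compact_prodT (Y : nat -> topologicalType) :
  (forall i, compact [set: Y i]) -> compact [set: prod_topology Y].
Proof.
move=> cptY.
have -> : [set: prod_topology Y] = [set x | forall i, [set: Y i] (x i)].
  by apply/seteqP; split.
exact: tychonoff cptY.
Qed.

(** Choose a point in each [G i]. The tail of this sequence from [i] on stays in the closed set
    [G i], so a cluster point of the sequence lies in every [G i]. *)
Lemma compact_decreasing (X : topologicalType) (G : nat -> set X) :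
  compact [set: X] -> (forall i, closed (G i)) -> (forall i, G i !=set0) ->
  (forall i, G i.+1 `<=` G i) -> \bigcap_i G i !=set0.
Proof.
move=> cptX clG G0 decG.
have decG' i k : G (k + i) `<=` G i.
  by elim: k => // k IH; exact: subset_trans (decG _) IH.
have [u Gu] := choice G0.
have [|p [_ clp]] := cptX (u @ \oo) _; first exact: filterT.
exists p => i _; apply: clG => B Bp.
apply: clp => //; exists i => // n /= le_in.
by rewrite -(subnK le_in); apply: decG'.
Qed.

(* The induction shifts the tower, so that only the lift upwards from
   coordinate 0 has to be built by recursion. *)
Lemma tower_lift (T : nat -> Type) (g : forall i, T i.+1 -> T i) :
  (forall i (y : T i), exists x, g i x = y) ->
  forall n (a : T n), exists s : forall i, T i,
    s n = a /\ forall i, g i (s i.+1) = s i.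
Proof.
move=> surj n; elim: n T g surj => [|n IH] T g surj a.
  pose s := fix s i : T i :=
    if i is i'.+1 then sval (cid (surj i' (s i'))) else a.
  by exists s; split=> // i; exact: svalP (cid (surj i (s i))).
have [s [sn sg]] := IH (fun i => T i.+1) (fun i => @g i.+1)
  (fun i => surj i.+1) a.
exists (fun i => if i is i'.+1 then s i' else g 0 (s 0)).
by split=> // -[|i]; last exact: sg.
Qed.

(** * Cylinder bases for a space with the initial topology of a tower *)

Section TowerBasis.
Variables (X : topologicalType) (Y : nat -> topologicalType).
Variables (p : forall i, X -> Y i) (g : forall i, Y i.+1 -> Y i).
Hypothesis p_continuous : forall i, continuous (p i).
Hypothesis g_continuous : forall i, continuous (@g i).
Hypothesis gp : forall i x, g (p i.+1 x) = p i x.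
Hypothesis p_initial : forall (F : set_system X) x, Filter F ->
  (forall i, p i @ F --> p i x) -> F --> x.

(** The sets containing a cylinder around [x] form a filter whose image under each [p i] converges
    to [p i x]. By initiality it converges to [x], so it contains every neighbourhood of [x]. *)
Lemma tower_nbhs x U : nbhs x U ->
  exists i, exists2 V, nbhs (p i x) V & p i @^-1` V `<=` U.
Proof.
pose cyl i : set_system X :=
  [set A | exists2 V, nbhs (p i x) V & p i @^-1` V `<=` A].
have cylS i : cyl i `<=` cyl i.+1.
  move=> A [V Vx sA]; exists (@g i @^-1` V).
    by apply: g_continuous; rewrite gp.
  by move=> z /=; rewrite gp; exact: sA.
have cylD i k : cyl i `<=` cyl (k + i).
  by elim: k => // k IH; exact: subset_trans IH (cylS _).
have cylF : Filter [set A | exists i, cyl i A].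
  split; first by exists 0, setT => //; exact: filterT.
    (* Cylinders over [i] and [j] are both cylinders over the later stage [j + i], where they can be
       intersected. *)
    move=> A B [i cA] [j cB]; exists (j + i).
    have [V Vx sA] := cylD _ j _ cA.
    have [W Wx sB] : cyl (j + i) B by rewrite addnC; exact: cylD.
    by exists (V `&` W); [exact: filterI|move=> z [/sA ? /sB ?]].
  by move=> A B sAB [i [V Vx sA]]; exists i, V => // z /sA /sAB.
by apply: (p_initial cylF) => i V Vx; exists i, V.
Qed.

Lemma tower_basis (B : forall i, set (set (Y i))) :
  (forall i, basis (B i)) ->
  basis (\bigcup_i [set p i @^-1` V | V in B i]).
Proof.
move=> basB; split=> [_ [i _ [V BV <-]]|x U].
  by move/continuousP: (p_continuous (i := i)); apply; apply: (basB i).1.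
move=> /tower_nbhs [i [V Vx sU]].
have [W [BW Wx] sW] := (basB i).2 _ _ Vx.
exists (p i @^-1` W); first by split=> //; exists i => //; exists W.
by move=> z /sW /sU.
Qed.

End TowerBasis.

(** * The limit system of a chain *)

Section Limit.
Variables (S : fullsubcat) (C : efchain S).

Local Notation L := (limit_space C).
Local Notation p := (@limit_proj S C).
Local Notation g i := (fac (chain_mor C i)).

Let cptC i : compact [set: C i].
Proof. by have [[]] := dynsysP (C i). Qed.

Let hC i : hausdorff_space (C i).
Proof. by have [[]] := dynsysP (C i). Qed.

Lemma step_closed i : closed [set q : C i * C i | step q.1 q.2].
Proof. by have [_ []] := dynsysP (C i); exact: closed_graph. Qed.

(** Condition (i) only provides some related states with a transition; single-valuedness forces them
    to be the images under the factor. *)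
Lemma fac_step i (x x' : C i.+1) : step x x' -> step (g i x) (g i x').
Proof.
have [[_ _ + _] _ _] := fac_factor (chain_mor C i).
by move=> /[apply] -[_ [_ [-> ->]]].
Qed.

Lemma fac_step_lift i (y y' : C i) : step y y' ->
  exists x x', [/\ g i x = y, g i x' = y' & step x x'].
Proof.
have [[_ _ _ +] _ _] := fac_factor (chain_mor C i).
by move=> /[apply] -[x [x' [-> ->]]]; exists x, x'.
Qed.

Lemma fac_continuous i : continuous (g i).
Proof.
by have [[_ + _ _] _ _] := fac_factor (chain_mor C i); exact: mfun_continuous.
Qed.

Lemma fac_graph_closed i : closed [set q : C i.+1 * C i | q.2 = g i q.1].
Proof.
have [[clf uhcf _ _] _ _] := fac_factor (chain_mor C i).
exact: closed_graph (@cptC i) (@hC i) clf uhcf.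
Qed.

Lemma limit_setP (x : prod_topology (fun i => space (C i))) :
  limit_set x <-> forall i, g i (x i.+1) = x i.
Proof.
(* At gap 1, [bond] computes to the single factor [g i]. *)
split=> [xL i|xg i k]; first exact: (xL i 1).
by elim: k => //= k IH; rewrite -IH; congr bond; exact: xg.
Qed.

Lemma limit_projP (s : forall i, C i) :
  (forall i, g i (s i.+1) = s i) -> exists x : L, forall i, p i x = s i.
Proof.
by move=> /limit_setP sL; exists (@exist _ _ s (mem_set sL)).
Qed.

Lemma limit_proj_fac i (x : L) : g i (p i.+1 x) = p i x.
Proof. by have /limit_setP := set_valP x; exact. Qed.

Lemma limit_proj_continuous i : continuous (p i).
Proof.
move=> x; apply: (@continuous_comp _ _ _ (set_val : L -> _) (fun y => y i)).
  exact: initial_continuous.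
exact: coord_continuous.
Qed.

(** The limit has the initial topology for its inclusion into the product, which in turn has the
    supremum of the initial topologies of its coordinates. *)
Lemma limit_initial (F : set_system L) x : Filter F ->
  (forall i, p i @ F --> p i x) -> F --> x.
Proof.
move=> FF pF.
have vF : set_val @ F --> (set_val x : prod_topology (fun i => space (C i))).
  apply/cvg_sup => i A [_ [[V oV <-] Vx] sA].
  apply: (filterS sA); apply: pF; exact: open_nbhs_nbhs.
move=> A [_ [[W oW <-] Wx] sA].
apply: (filterS sA); apply: vF; exact: open_nbhs_nbhs.
Qed.

Lemma limit_proj_surj i (y : C i) : exists x : L, p i x = y.
Proof.
have [|s [si sg]] := @tower_lift (fun i => C i) (fun i => g i) _ i y.
  by move=> j; have [] := fac_factor (chain_mor C j).
by have [x px] := limit_projP sg; exists x; rewrite px.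
Qed.

(** Each one-step compatibility condition is the preimage of the closed graph of a factor under two
    coordinates. *)
Lemma limit_set_closed : closed (@limit_set S C).
Proof.
have -> : @limit_set S C = \bigcap_i
    [set x : prod_topology (fun i => space (C i)) | x i = g i (x i.+1)].
  apply/seteqP; split=> x; first by move=> /limit_setP xg i _ /=; rewrite xg.
  by move=> xg; apply/limit_setP => i; rewrite -(xg i I).
apply: closed_bigI => i _.
exact: closed_preimage2 (@fac_graph_closed i)
  (@coord_continuous _ i.+1) (@coord_continuous _ i).
Qed.

Lemma limit_compact : compact [set: L].
Proof.
apply: set_type_compact.
apply: (subclosed_compact limit_set_closed (B := setT)).
  exact: compact_prodT cptC.
exact: subsetT.
Qed.

Lemma limit_hausdorff : hausdorff_space L.
Proof.
move=> x y clxy; apply: val_inj; apply: (hausdorff_product hC) => A B Ax By.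
have sv : continuous (set_val : L -> prod_topology (fun i => space (C i))).
  exact: initial_continuous.
have [z [Az Bz]] := clxy _ _ (sv x A Ax) (sv y B By).
by exists (set_val z).
Qed.

Lemma limit_step_closed :
  closed [set q : limit_sys C * limit_sys C | step q.1 q.2].
Proof.
have -> : [set q : limit_sys C * limit_sys C | step q.1 q.2] =
    \bigcap_i [set q : L * L | step (p i q.1) (p i q.2)].
  by apply/seteqP; split=> q h i; [move=> _; exact: h|exact: (h i I)].
apply: closed_bigI => i _.
apply: (closed_preimage2 (@step_closed i)) => q.
  apply: (@continuous_comp _ _ _ fst (p i)); first exact: cvg_fst.
  exact: limit_proj_continuous.
apply: (@continuous_comp _ _ _ snd (p i)); first exact: cvg_snd.
exact: limit_proj_continuous.
Qed.

Lemma limit_dynsys : is_dynsys (limit_sys C).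
Proof.
have tb := tower_basis (@limit_proj_continuous) (@fac_continuous)
  (@limit_proj_fac) (@limit_initial).
split; last first.
  split; first exact: closed_graph_valued limit_step_closed.
  exact: closed_graph_uhc limit_compact limit_step_closed.
split; [| |exact: limit_compact|exact: limit_hausdorff].
  have [i|B BP] := @choice_dep _ _ (fun i (B : set (set (C i))) =>
      B `<=` clopen /\ basis B).
    by have [[[B cB bB] _ _ _] _] := dynsysP (C i); exists B.
  exists (\bigcup_i [set p i @^-1` V | V in B i]); last first.
    by apply: tb => i; exact: (BP i).2.
  move=> _ [i _ [V BV <-]]; have [oV cV] := (BP i).1 _ BV; split.
    by move/continuousP: (@limit_proj_continuous i); exact.
  by move/continuous_closedP: (@limit_proj_continuous i); exact.
have [i|B BP] := @choice_dep _ _ (fun i (B : set (set (C i))) =>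
    countable B /\ basis B).
  by have [[_ [B cB bB] _ _] _] := dynsysP (C i); exists B.
exists (\bigcup_i [set p i @^-1` V | V in B i]); last first.
  by apply: tb => i; exact: (BP i).2.
apply: bigcup_countable => // i _.
exact: sub_countable (card_image_le _ _) (BP i).1.
Qed.

(** The transitions of the stages themselves form a tower under the factors, surjective by condition
    (ii). A thread of transitions splits into two points of the limit. *)
Lemma limit_nontrivial : nontrivial (C 0) ->
  exists x x' : limit_sys C, step x x'.
Proof.
move=> [a [a' aa']].
pose T i := {q : C i * C i | step q.1 q.2}.
pose h i (q : T i.+1) : T i := @exist _ _ (g i (sval q).1, g i (sval q).2)
  (fac_step (svalP q)).
have [|s [_ sh]] := @tower_lift T h _ 0 (@exist _ _ (a, a') aa').
  move=> i [[y y'] /= yy']; have [x [x' [gx gx' xx']]] := fac_step_lift yy'.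
  (* Proof irrelevance reduces equality of transitions to equality of their endpoints. *)
  by exists (@exist _ _ (x, x') xx'); apply: eq_exist => /=; rewrite gx gx'.
have [|x px] := @limit_projP (fun i => (sval (s i)).1).
  by move=> i; rewrite -(sh i).
have [|x' px'] := @limit_projP (fun i => (sval (s i)).2).
  by move=> i; rewrite -(sh i).
by exists x, x' => i; rewrite px px'; exact: svalP (s i).
Qed.

Lemma limit_total : (forall i, total_sys (C i)) -> mtotal (@step (limit_sys C)).
Proof.
move=> totC x.
have [|||x' xx'] := compact_decreasing
  (G := fun i => p i @^-1` step (p i x)) limit_compact.
- move=> i; have /continuous_closedP := @limit_proj_continuous i; apply.
  by have [_ []] := dynsysP (C i).
(* Nonemptiness: a successor at stage [i] extends to a whole thread, as projections are
   surjective. *)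
- move=> i; have [y xy] := totC i (p i x).
  by have [z pz] := limit_proj_surj y; exists z; rewrite /= pz.
(* The sets decrease because factors preserve transitions. *)
- by move=> i z /= /fac_step; rewrite !limit_proj_fac.
by exists x' => i; exact: (xx' i I).
Qed.

End Limit.

(** * Finite discrete images *)

Lemma image_dynsys (X : relsys) (Y : discreteTopologicalType) (f : X -> Y) :
  finite_set [set: Y] -> is_dynsys (image_sys f).
Proof.
move=> finY.
(* The singletons serve both as the clopen basis and as the countable one. *)
have singletons_basis : basis (range (@set1 Y)).
  split=> [A _|y U Uy]; first exact: discrete_open.
  exists [set y]; first by split=> //; exists y.
  by move=> _ ->; exact: nbhs_singleton.
split; split.
- exists (range (@set1 Y)) => // A _.
  by split; [exact: discrete_open|exact: discrete_closed].
- exists (range (@set1 Y)) => //.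
  exact/finite_set_countable/finite_image.
- exact: finite_compact.
- exact: discrete_hausdorff.
- by move=> y; exact: discrete_closed.
- move=> y V _ sV; exists [set y]; split=> //; first exact: discrete_open.
  by move=> _ ->.
Qed.

Lemma image_nontrivial (X : dynsys) (Y : topologicalType) (f : X -> Y) :
  nontrivial X -> exists y y' : image_sys f, step y y'.
Proof. by move=> [x [x' xx']]; exists (f x), (f x'), x, x'. Qed.

Lemma image_total (X : dynsys) (Y : topologicalType) (f : X -> Y) :
  (forall y, exists x, f x = y) -> total_sys X -> mtotal (@step (image_sys f)).
Proof.
move=> surj totX y; have [x <-] := surj y; have [x' xx'] := totX x.
by exists (f x'), x, x'.
Qed.

Theorem theorem6p3 :
  (closed_under_limits allSys /\ closed_under_finite_images allSys) /\
  (closed_under_limits Sys /\ closed_under_finite_images Sys) /\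
  (closed_under_limits totalSys /\ closed_under_finite_images totalSys).
Proof.
split; [|split]; split=> [C|X Y f SX finY _ surj].
(* The equality required by [obj_in] holds by computation, since the packed system is [limit_sys C]
   itself; the same holds for the images below. *)
- by exists (DynSys (limit_dynsys C)).
- by exists (DynSys (image_dynsys f finY)).
- exists (DynSys (limit_dynsys C)) => //.
  exact/limit_nontrivial/(chain_in C 0).
- exists (DynSys (image_dynsys f finY)) => //.
  exact: image_nontrivial.
- exists (DynSys (limit_dynsys C)) => //; split.
    by apply: limit_total => i; have [] := chain_in C i.
  by apply: limit_nontrivial; have [] := chain_in C 0.
- have [totX ntX] := SX.
  exists (DynSys (image_dynsys f finY)) => //; split.
    exact: image_total.
  exact: image_nontrivial.
Qed.
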